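(* Let $D$ be an integral domain with quotient field $K$, and let $\mathbf{X}$ be a family of indeterminates over $K$. If $R$ is a $D$-algebra contained in $K[\mathbf{X}]$ and $R\cap K$ is pseudo-polynomial over $D$, then $R$ is pseudo-polynomial over $D$. In particular, if $R\cap K=D$ then $R$ is pseudo-polynomial over $D$.
   Context: $D$ is an integral domain that is not a field. For an extension $D\subseteq B$ of integral domains (with the quotient field $K$ of $D$ viewed inside that of $B$), an ideal $I$ of $B$ is unitary with respect to $D$ if $I\cap K\neq(0)$. $B$ is pseudo-polynomial over $D$ if every principal integral ideal (i.e. principal ideal contained in $B$) of $B$ that is unitary with respect to $D$ is generated by an element of $D$. *)

(* Defs.v *)
From HB Require Import structures.
From mathcomp Require Import all_boot all_order all_algebra.
From mathcomp Require Import boolp classical_sets.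
From mathcomp Require Import finmap.
From mathcomp.multinomials Require Import monalg.

Set Implicit Arguments.
Unset Strict Implicit.
Unset Printing Implicit Defensive.

Import GRing.Theory.
Local Open Scope ring_scope.

(* The polynomial ring R[X_i | i : I] in an arbitrary family of indeterminates
   is {malg R[{cmonom I}]}: finitely supported functions from the commutative
   monomials over I to R. The library equips it with its ring structure only;
   we show here that it is an integral domain whenever R is one, which is
   needed to form its field of fractions. *)

Section SeparatingWeight.
Context (I : choiceType).
Implicit Types (m : cmonom I) (s : seq I) (S : seq (cmonom I)).

Definition cmweight (b : nat) s m : nat :=
  foldr (fun i w => m i + b * w)%N 0%N s.

Lemma cmweightM b s : {morph cmweight b s : m1 m2 / mmul m1 m2 >-> (m1 + m2)%N}.
Proof.
by move=> m1 m2; elim: s => //= i s ->; rewrite cmM mulnDr addnACA.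
Qed.

Lemma cmweight_inj b s m1 m2 :
    (forall i, m1 i < b)%N -> (forall i, m2 i < b)%N ->
  cmweight b s m1 = cmweight b s m2 -> {in s, m1 =1 m2}.
Proof.
move=> lt1 lt2; elim: s => //= i s IHs eq_w.
have b_gt0 : (0 < b)%N by apply: leq_trans (lt1 i).
have eq_i : m1 i = m2 i.
  have := congr1 (modn^~ b) eq_w.
  by rewrite /= !(mulnC b) ![(_ + _ * b)%N]addnC !modnMDl !modn_small.
move: eq_w; rewrite eq_i => /addnI/eqP; rewrite eqn_pmul2l // => /eqP/IHs eq_s.
by move=> j; rewrite inE => /predU1P[->|/eq_s].
Qed.

Lemma cmexp_le_mdeg m i : (m i <= mdeg m)%N.
Proof.
rewrite mdegE; case: (mdomP m i) => // mi.
by rewrite (big_fsetD1 i) //= leq_addr.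
Qed.

Lemma cmweight_separating S : exists w : cmonom I -> nat,
  {morph w : m1 m2 / mmul m1 m2 >-> (m1 + m2)%N} /\ {in S &, injective w}.
Proof.
pose b := (\max_(m <- S) mdeg m).+1.
pose s := flatten [seq (finsupp (cmonom_val m) : seq I) | m <- S].
exists (cmweight b s); split; first exact: cmweightM.
have lt_b m : m \in S -> forall i, (m i < b)%N.
  move=> mS i; rewrite ltnS (leq_trans (cmexp_le_mdeg m i)) //.
  by rewrite (big_rem m) //= leq_maxl.
have out_s m i : m \in S -> i \notin s -> m i = 0%N.
  move=> mS; apply: contraNeq; rewrite cmE_neq0 => im.
  by apply/flattenP; exists (finsupp (cmonom_val m) : seq I) => //; apply/mapP; exists m.
move=> m1 m2 m1S m2S /(cmweight_inj (lt_b _ m1S) (lt_b _ m2S)) eq_s.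
apply/eqP/cmP => i; case: (boolP (i \in s)) => [/eq_s //|i_s].
by rewrite !(out_s _ i).
Qed.

End SeparatingWeight.

Section PolynomialDomain.
Context (I : choiceType) (R : idomainType).
Local Notation poly := {malg R[{cmonom I}]}.
Implicit Types f g : poly.

Lemma malg_lead (w : cmonom I -> nat) f : f != 0 ->
  exists2 a, a \in msupp f & {in msupp f, forall m, w m <= w a}%N.
Proof.
rewrite -msupp_eq0 => /fset0Pn[m0 m0f].
have bound k : [exists m : msupp f, w (val m) == k] ->
    (k <= \max_(m <- msupp f) w m)%N.
  by case/existsP=> m /eqP<-; rewrite (big_fsetD1 (val m)) ?fsvalP //= leq_maxl.
have ex : exists k, [exists m : msupp f, w (val m) == k].
  by exists (w m0); apply/existsP; exists [` m0f]%fset.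
case: (ex_maxnP ex bound) => k /existsP[a /eqP wa] max_k.
exists (val a); first exact: fsvalP.
by move=> m mf; rewrite wa; apply: max_k; apply/existsP; exists [` mf]%fset.
Qed.

Lemma malg_leadM (w : cmonom I -> nat) f g a b :
    {morph w : m1 m2 / mmul m1 m2 >-> (m1 + m2)%N} ->
    {in msupp f &, injective w} -> {in msupp g &, injective w} ->
    a \in msupp f -> {in msupp f, forall m, w m <= w a}%N ->
    b \in msupp g -> {in msupp g, forall m, w m <= w b}%N ->
  (f * g)@_(mmul a b) = f@_a * g@_b.
Proof.
move=> wM injf injg af maxa bg maxb.
have key m n : m \in msupp f -> n \in msupp g ->
    mmul m n = mmul a b -> m = a /\ n = b.
  move=> mf ng /(congr1 w); rewrite !wM => eq_w.
  have le_m := maxa _ mf; have le_n := maxb _ ng.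
  have eq_m : w m = w a.
    apply/eqP; rewrite eqn_leq le_m /= -(leq_add2r (w n)) eq_w leq_add2l.
    exact: le_n.
  split; first exact: injf.
  by apply: injg => //; apply: (@addnI (w a)); rewrite -eq_w eq_m.
have other m : m \in msupp f -> m != a ->
    \sum_(n <- msupp g) (f@_m * g@_n) *+ (mmul m n == mmul a b) = 0.
  move=> mf ma; rewrite big_seq; apply: big1 => n ng.
  by case: eqP => // /(key _ _ mf ng)[eq_m _]; rewrite eq_m eqxx in ma.
have leading :
    \sum_(n <- msupp g) (f@_a * g@_n) *+ (mmul a n == mmul a b) = f@_a * g@_b.
  rewrite (bigD1_seq b) ?fset_uniq //= eqxx mulr1n big_seq_cond.
  rewrite big1 ?addr0 // => n /andP[ng nb].
  by case: eqP => // /(key _ _ af ng)[_ eq_n]; rewrite eq_n eqxx in nb.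
rewrite mcoeffMl (bigD1_seq a) ?fset_uniq //= leading big_seq_cond.
by rewrite big1 ?addr0 // => m /andP[mf ma]; apply: other.
Qed.

Lemma malg_leadP f g : f != 0 -> g != 0 ->
  exists a b, [/\ (f * g)@_(mmul a b) != 0,
    b = mone -> g = (g@_mone)%:MP & a = mone -> f = (f@_mone)%:MP].
Proof.
move=> f0 g0.
have [w [wM w_inj]] :=
  cmweight_separating (mone :: (msupp f : seq _) ++ (msupp g : seq _)).
have w1 : w mone = 0%N by apply: (@addnI (w mone)); rewrite -wM mulm1 addn0.
have injf : {in msupp f &, injective w}.
  by move=> m n mf nf; apply: w_inj; rewrite inE mem_cat ?mf ?nf orbT.
have injg : {in msupp g &, injective w}.
  by move=> m n mg ng; apply: w_inj; rewrite inE mem_cat ?mg ?ng !orbT.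
have const h c : {subset msupp h <= mone :: (msupp f : seq _) ++ (msupp g : seq _)} ->
    {in msupp h, forall m, w m <= w c}%N -> c = mone -> h = (h@_mone)%:MP.
  move=> sub maxc c1; apply/malgP => m; rewrite mcoeffC.
  case: eqP => [->|m1]; first by rewrite mulr1n.
  rewrite mulr0n; apply/mcoeff_outdom/negP => mh; apply: m1.
  apply: w_inj; rewrite ?inE ?eqxx //; first by have := sub _ mh; rewrite inE.
  by apply/eqP; rewrite w1 -leqn0 -w1 -c1 maxc.
have [a af maxa] := malg_lead w f0; have [b bg maxb] := malg_lead w g0.
exists a, b; split.
- by rewrite (malg_leadM wM) // mulf_neq0 // mcoeff_neq0.
- by apply: const maxb => m mg; rewrite inE mem_cat mg !orbT.
- by apply: const maxa => m mf; rewrite inE mem_cat mf orbT.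
Qed.

Definition malg_unit : {pred poly} :=
  fun f => (f == (f@_mone)%:MP) && (f@_mone \is a GRing.unit).

Definition malg_inv f : poly :=
  if malg_unit f then ((f@_mone)^-1)%:MP else f.

Lemma malgC_mulVr (c : R) :
  c \is a GRing.unit -> (c^-1)%:MP * c%:MP = 1 :> poly.
Proof. by move=> uc; rewrite -mpolyCM mulVr // mpolyC1E. Qed.

Lemma malg_mulVx : {in malg_unit, left_inverse 1 malg_inv *%R}.
Proof.
move=> f uf; rewrite /malg_inv.
have -> : malg_unit f by [].
case/andP: uf => /eqP f_const uf.
rewrite [X in _ * X]f_const.
exact: malgC_mulVr.
Qed.

Lemma malg_unitPl f g : g * f = 1 -> malg_unit f.
Proof.
move=> gf1.
have f0 : f != 0 by apply: contra_eq_neq gf1 => ->; rewrite mulr0 eq_sym oner_eq0.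
have g0 : g != 0 by apply: contra_eq_neq gf1 => ->; rewrite mul0r eq_sym oner_eq0.
have [a [b [ab Hf Hg]]] := malg_leadP g0 f0.
move: ab; rewrite gf1 mcoeff1; case: (mmul a b =P mone) => [ab1 _|]; last by rewrite eqxx.
have [a1 b1] := unitm _ _ ab1.
apply/andP; split; first by rewrite -Hf.
apply/unitrPr; exists (g@_mone).
by have := rmorphM (mcoeff mone) g f; rewrite /= gf1 rmorph1 mulrC => <-.
Qed.

Lemma malg_inv_out : {in [predC malg_unit], malg_inv =1 id}.
Proof. by move=> f /negP uf; rewrite /malg_inv; case: ifP => // /uf. Qed.

HB.instance Definition _ :=
  GRing.ComNzRing_hasMulInverse.Build (malg (cmonom I) R)
    malg_mulVx malg_unitPl malg_inv_out.

Lemma malg_integral : GRing.integral_domain_axiom poly.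
Proof.
move=> f g fg0; apply/negPn; rewrite negb_or; apply/negP => /andP[f0 g0].
have [a [b [+ _ _]]] := malg_leadP f0 g0.
by rewrite fg0 mcoeff0 eqxx.
Qed.

HB.instance Definition _ :=
  GRing.ComUnitRing_isIntegral.Build (malg (cmonom I) R) malg_integral.

End PolynomialDomain.

Local Open Scope classical_set_scope.

(* Extensions D `<=` B of subrings of an integral domain A. The quotient field
   of D is viewed inside that of A, which contains the quotient field of B. *)
Section PseudoPolynomial.
Context (A : idomainType).
Implicit Types D B J : set A.

Definition quotient_field D : set {fraction A} :=
  [set x | exists a b, [/\ D a, D b, b != 0 & x = tofrac a / tofrac b]].

Definition unitary D J : Prop :=
  (@tofrac A @` J) `&` quotient_field D <> [set 0].

Definition generated_ideal B (c : A) : set A := [set c * b | b in B].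

Definition principal_integral_ideal B J : Prop :=
  exists2 c, B c & J = generated_ideal B c.

Definition pseudo_polynomial D B : Prop :=
  forall J, principal_integral_ideal B J -> unitary D J ->
    exists2 d, D d & J = generated_ideal B d.

End PseudoPolynomial.

Section SubalgebrasOfKX.
Context (D : idomainType) (I : choiceType).
Local Notation K := {fraction D}.
Local Notation KX := {malg K[{cmonom I}]}.

Definition base_ring : set KX := range (fun d : D => (tofrac d)%:MP).

Definition constants : set KX := range (fun k : K => k%:MP).

Definition is_subalgebra (R : set KX) : Prop :=
  GRing.subring_closed (mem R) /\ base_ring `<=` R.

End SubalgebrasOfKX.

Arguments base_ring D I : clear implicits.
Arguments constants D I : clear implicits.

(* Main.v *)
(* If f * g lies in K and is nonzero, then f is a unit of K[X], hence a constant,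
   and likewise g. So a unitary principal ideal f R has its generator in R ∩ K,
   where f (R ∩ K) is still unitary; a generator d in D of f (R ∩ K) generates
   f R as well. *)
Require Import Defs.
From mathcomp Require Import all_boot all_order all_algebra.
From mathcomp Require Import boolp classical_sets.
From mathcomp Require Import finmap.
From mathcomp.multinomials Require Import monalg.
Import GRing.Theory.
Local Open Scope ring_scope.
Local Open Scope classical_set_scope.

(** Since [1] is in [B], each generator is a [B]-multiple of the other; the multipliers lie in [C],
    which absorbs them by closure under products. *)
Lemma generated_idealS (A : idomainType) (B C : set A) (c d : A) :
    B `<=` C -> B 1 -> (forall x y, C x -> C y -> C (x * y)) ->
  generated_ideal B c = generated_ideal B d ->
  generated_ideal C c = generated_ideal C d.
Proof.
move=> BC B1 CM eqB.
have sub x y : generated_ideal B x = generated_ideal B y ->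
    generated_ideal C x `<=` generated_ideal C y.
  move=> eq_xy _ [z Cz <-].
  have : generated_ideal B x x by exists 1 => //; rewrite mulr1.
  rewrite eq_xy => -[b Bb <-].
  by exists (b * z); [apply: CM => //; apply: BC | rewrite mulrA].
by apply/seteqP; split; apply: sub.
Qed.

Lemma pseudo_polynomial_refl (A : idomainType) (D : set A) :
  pseudo_polynomial D D.
Proof. by move=> J [c Dc ->] _; exists c. Qed.

(** Dividing by [k] exhibits [k^-1 * g] as an inverse of [f], and units of a polynomial ring over a
    field are constants. *)
Lemma malg_mul_const (I : choiceType) (K : fieldType)
    (f g : {malg K[{cmonom I}]}) (k : K) :
  k != 0 -> f * g = k%:MP -> f = (f@_mone)%:MP.
Proof.
move=> k0 fg; have kV : (k^-1)%:MP * k%:MP = 1 :> {malg K[{cmonom I}]}.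
  by apply: malgC_mulVr; rewrite unitfE.
move: kV; rewrite -fg [f * g]mulrC (mulrA _ g f).
by move=> /malg_unitPl/andP[/eqP].
Qed.

(** Clearing denominators in [c * b = s / t] turns unitarity into an equation inside [A], free of
    fractions. *)
Lemma unitary_generatedP (A : idomainType) (D B : set A) (c : A) :
    D 0 -> D 1 -> B 0 ->
  unitary D (generated_ideal B c) <->
  exists b s t, [/\ B b, D s, D t & [/\ s != 0, t != 0 & c * b * t = s]].
Proof.
move=> D0 D1 B0; split=> [nz|[b [s [t [Bb Ds Dt [s0 t0 cbt]]]]] eq0].
(* Without such a triple the intersection is exactly [[set 0]]: it contains [0 = c * 0 = 0 / 1], and
   any nonzero element would supply a triple. *)
- apply: contra_notP nz => none; apply/seteqP; split=> x /=; last first.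
    move=> ->; split; first by exists 0; [exists 0; rewrite ?mulr0 | rewrite rmorph0].
    by exists 0, 1; rewrite oner_neq0 rmorph0 mul0r.
  case=> -[_ [b Bb <-] <-] [s [t [Ds Dt t0 eq_st]]].
  have ft0 : tofrac t != 0 by rewrite tofrac_eq0.
  have [s0|s0] := eqVneq s 0; first by rewrite eq_st s0 rmorph0 mul0r.
  case: none; exists b, s, t; split=> //; split=> //.
  by apply/eqP; rewrite -tofrac_eq rmorphM /= eq_st divfK.
(* The element [c * b = s / t] lies in the intersection, so it would vanish, and [s] with it. *)
- have : [set 0] (tofrac (c * b)).
    rewrite -eq0; split; first by exists (c * b) => //; exists b.
    exists s, t; split=> //.
    by rewrite -cbt [tofrac (_ * t)]rmorphM /= mulfK ?tofrac_eq0.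
  move=> /eqP; rewrite tofrac_eq0 => /eqP cb0.
  by move: s0; rewrite -cbt cb0 mul0r eqxx.
Qed.

Lemma pseudo_polynomial_constants (D : idomainType) (I : choiceType)
    (R : set {malg {fraction D}[{cmonom I}]}) (R_subalg : is_subalgebra R) :
  pseudo_polynomial (base_ring D I) (R `&` constants D I) ->
  pseudo_polynomial (base_ring D I) R.
Proof.
case: R_subalg => [[R1 RB RM] DR] ppB.
have {}R1 : R 1 by have := R1; rewrite in_setE.
have {}RM x y : R x -> R y -> R (x * y).
  by have := RM x y; rewrite !in_setE; apply.
have D0 : base_ring D I 0 by exists 0; rewrite ?tofrac0 ?malgC0E.
have D1 : base_ring D I 1 by exists 1; rewrite ?tofrac1 ?mpolyC1E.
have R0 : R 0 by apply: DR.
have C0 : constants D I 0 by exists 0; rewrite ?malgC0E.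
have C1 : constants D I 1 by exists 1; rewrite ?mpolyC1E.
move=> _ [f Rf ->] /(unitary_generatedP _ _ _ _ D0 D1 R0)[g [s [t]]].
move=> [Rg Ds Dt [s0 t0 fgt]].
have [k _ sk] := Ds.
have k0 : tofrac k != 0 by apply: contra_neq s0 => k0; rewrite -sk k0 malgC0E.
(* The product [f * g * t = s] is a nonzero constant; grouping it as [f * (g * t)], then as
   [g * (f * t)], makes both [f] and [g] constant. *)
have Cf : constants D I f.
  exists (f@_mone) => //; apply/esym/(malg_mul_const _ _ _ (g * t) _ k0).
  by rewrite mulrA fgt -sk.
have Cg : constants D I g.
  exists (g@_mone) => //; apply/esym/(malg_mul_const _ _ _ (f * t) _ k0).
  by rewrite mulrCA mulrA fgt -sk.
have [||d Dd eq_d] := ppB (generated_ideal (R `&` constants D I) f).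
- by exists f.
(* The same witnesses serve over the smaller ring because the cofactor [g] is itself a constant. *)
- by apply/(unitary_generatedP _ _ _ _ D0 D1 (conj R0 C0)); exists g, s, t.
exists d; first exact: Dd.
exact: (generated_idealS _ _ _ _ _ (@subIsetl _ R _) (conj R1 C1) RM eq_d).
Qed.

Theorem proposition5p7 (D : idomainType) (D_nonfield : ~ GRing.field_axiom D)
    (I : choiceType) (R : set {malg {fraction D}[{cmonom I}]})
    (R_subalg : is_subalgebra R) :
  (pseudo_polynomial (base_ring D I) (R `&` constants D I) ->
     pseudo_polynomial (base_ring D I) R) /\
  (R `&` constants D I = base_ring D I ->
     pseudo_polynomial (base_ring D I) R).
Proof.
split=> [|RK]; first exact: pseudo_polynomial_constants.
(* Here the ring of constants of [R] is the base ring, so each generator already lies in it. *)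
apply: pseudo_polynomial_constants => //; rewrite RK.
exact: pseudo_polynomial_refl.
Qed.
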